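(* Let $a$ and $b$ be nonnegative reals with $b\neq 0$ and let $k$ be an integer with $k\ge 3$, such that $\psi_k(G) \le a\,|V(G)|+b\,|E(G)|$ holds for every graph $G$. Moreover, let $x$ be an arbitrary positive integer which satisfies $$\frac{1-a-b}{b} \le x \le \frac{2-2a}{b},$$ and define $a'$ and $b'$ as follows: $$a'=a+bx- \frac{x(1+b-a)}{x+2}, \qquad b'=\frac{2-2a-bx}{x+2}.$$ Then the inequality $$\psi_k(G) \le a'\,|V(G)|+b'\,|E(G)|$$ holds for every graph $G$.
   Context: Graphs are finite, simple and undirected. $P_k$ denotes the path with $k$ vertices. A $k$-path vertex cover of $G$ is a set $T\subseteq V(G)$ such that $G-T$ contains no (not necessarily induced) subgraph isomorphic to $P_k$. $\psi_k(G)$ is the minimum cardinality of a $k$-path vertex cover of $G$. *)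

(* Defs.v *)
From mathcomp Require Import all_boot.
Set Implicit Arguments.
Unset Strict Implicit.
Unset Printing Implicit Defensive.

Record sgraph := SGraph {
  vertex :> finType;
  adj : rel vertex;
  adj_sym : symmetric adj;
  adj_irr : irreflexive adj
}.

Definition edges (G : sgraph) : {set {set G}} :=
  [set e : {set G} | [exists u, exists v, adj u v && (e == [set u; v])]].

Section PathGraph.
Variable k : nat.

Definition path_adj : rel 'I_k := 
  [rel i j : 'I_k | (i.+1 == j :> nat) || (j.+1 == i :> nat)].

Lemma path_adj_sym : symmetric path_adj.
Proof. by move=> i j; rewrite /path_adj /= orbC. Qed.

Lemma path_adj_irr : irreflexive path_adj.
Proof. by move=> i; rewrite /path_adj /= orbb eqn_leq ltnn. Qed.

(* P_k: the path with k vertices (not k edges). *)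
Definition path_graph : sgraph := SGraph path_adj_sym path_adj_irr.

End PathGraph.

Section Delete.
Variables (G : sgraph) (T : {set G}).

Definition del_adj : rel {v : G | v \notin T} :=
  [rel u v | adj (val u) (val v)].

Lemma del_adj_sym : symmetric del_adj.
Proof. by move=> u v; exact: adj_sym. Qed.

Lemma del_adj_irr : irreflexive del_adj.
Proof. by move=> u; exact: adj_irr. Qed.

Definition del_vertices : sgraph := SGraph del_adj_sym del_adj_irr.

End Delete.

(* G has a subgraph isomorphic to H: since adjacency need not be reflected,
   the subgraph is not required to be induced. *)
Definition contains_subgraph (H G : sgraph) : bool :=
  [exists f : {ffun H -> G},
     injectiveb f && [forall u, forall v, adj u v ==> adj (f u) (f v)]].

Definition path_vertex_cover (k : nat) (G : sgraph) (T : {set G}) : bool :=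
  ~~ contains_subgraph (path_graph k) (del_vertices T).

Lemma path_vertex_coverT (k : nat) (G : sgraph) :
  0 < k -> path_vertex_cover k [set: G].
Proof.
move=> k_gt0; apply/existsP => -[f _].
by have := valP (f (Ordinal k_gt0)); rewrite inE.
Qed.

(* For k > 0 the default setT is a k-path vertex cover, so psi k G is a minimum
   over a nonempty family; the value at k = 0 is meaningless. *)
Definition psi (k : nat) (G : sgraph) : nat :=
  #|[arg min_(T < [set: G] | path_vertex_cover k T) #|T|]|.

(* Main.v *)
Require Import Defs.
From mathcomp Require Import all_boot all_order all_algebra.
From mathcomp Require Import reals.
From mathcomp Require Import ring lra.
Set Implicit Arguments.
Unset Strict Implicit.
Unset Printing Implicit Defensive.
Import Order.TTheory GRing.Theory Num.Theory.
Local Open Scope ring_scope.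

(** The lines [a + b d / 2] and [a' + b' d / 2], which give the two bounds per
    vertex as functions of the average degree [d], cross at [d = x]; the lower
    bound on [x] says that the new line is the flatter one.  If
    all degrees are at most [x], so is the average degree, by double counting
    ([card_edges_le]), and the new bound follows from the old one.  Otherwise
    some vertex has degree at least [x + 1].  Deleting it lowers [psi] by at
    most 1 ([psi_del_vertices]) and the new bound by at least
    [a' + b' (x + 1)], since the upper bound on [x] makes [b'] nonnegative.  The
    parameters are chosen so that [a' + b' (x + 1) = 1], and induction on the
    number of vertices concludes. *)

(** Its cardinal is the degree of [v]: counting incident edges rather than
    neighbours makes the degree the number of edges lost by deleting [v]. *)
Definition incident (G : sgraph) (v : G) : {set {set G}} :=
  [set e in edges G | v \in e].

Lemma edgesP (G : sgraph) (e : {set G}) :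
  reflect (exists u v, adj u v /\ e = [set u; v]) (e \in edges G).
Proof.
rewrite inE; apply: (iffP existsP) => [[u /existsP[v /andP[uv /eqP ->]]]|].
  by exists u, v.
by move=> [u [v [uv ->]]]; exists u; apply/existsP; exists v; rewrite uv eqxx.
Qed.

Lemma card_edge (G : sgraph) (e : {set G}) : e \in edges G -> #|e| = 2%N.
Proof.
case/edgesP=> u [v [uv ->]]; rewrite cards2.
by case: eqVneq uv => // ->; rewrite adj_irr.
Qed.

Lemma handshake (G : sgraph) : (\sum_(v : G) #|incident v| = 2 * #|edges G|)%N.
Proof.
transitivity (\sum_(v : G) \sum_(e in edges G | v \in e) 1)%N.
  by apply: eq_bigr => v _; rewrite -sum1_card; apply: eq_bigl => e; rewrite inE.
rewrite (exchange_big_dep (mem (edges G))) /=; last by move=> v e _ /andP[].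
rewrite mulnC -sum_nat_const; apply: eq_bigr => e eG.
by rewrite -(card_edge eG) -sum1_card; apply: eq_bigl => v; rewrite eG.
Qed.

Lemma card_edges_le (G : sgraph) (d : nat) :
  (forall v : G, #|incident v| <= d)%N -> (2 * #|edges G| <= d * #|G|)%N.
Proof.
move=> deg_le; rewrite -handshake mulnC -sum_nat_const.
by apply: leq_sum => v _.
Qed.

Lemma edges_del_vertex (G : sgraph) (v : G) :
  (#|incident v| + #|edges (del_vertices [set v])| <= #|edges G|)%N.
Proof.
rewrite -(cardsID [set e : {set G} | v \in e] (edges G)).
apply: leq_add; first by apply/subset_leq_card/subsetP => e; rewrite !inE.
pose lift (e : {set del_vertices [set v]}) : {set G} := [set val u | u in e].
have lift_inj : injective lift := imset_inj val_inj.
rewrite -(card_imset _ lift_inj); apply/subset_leq_card/subsetP => e' /imsetP[e].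
move=> /edgesP[u [w [uw ->]]] ->{e'}; rewrite in_setD; apply/andP; split.
  rewrite inE; apply/imsetP => -[z _ vz]; have := valP z.
  by rewrite -vz in_set1 eqxx.
by apply/edgesP; exists (val u), (val w); rewrite /lift imsetU1 imset_set1.
Qed.

Lemma contains_subgraph_trans (H G1 G2 : sgraph) (h : G1 -> G2) :
  injective h -> (forall u v, adj u v -> adj (h u) (h v)) ->
  contains_subgraph H G1 -> contains_subgraph H G2.
Proof.
move=> h_inj h_adj /existsP[f /andP[/injectiveP f_inj /forallP f_adj]].
apply/existsP; exists [ffun u => h (f u)]; apply/andP; split.
  by apply/injectiveP => u w; rewrite !ffunE => /h_inj/f_inj.
apply/forallP => u; apply/forallP => w; apply/implyP => uw; rewrite !ffunE.
by apply: h_adj; have /forallP/(_ w)/implyP := f_adj u; apply.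
Qed.

(** Deleting [S] and then [T] leaves the same graph as deleting their union at
    once, up to the nesting of subtypes, which the embedding [h] undoes. *)
Lemma path_vertex_coverU (k : nat) (G : sgraph) (S : {set G})
    (T : {set del_vertices S}) :
  path_vertex_cover k T -> path_vertex_cover k (S :|: [set val u | u in T]).
Proof.
apply: contraNN; set U := S :|: _.
have notS (u : del_vertices U) : val u \notin S.
  by have := valP u; rewrite inE => /norP[].
pose inner (u : del_vertices U) : del_vertices S := Sub (val u) (notS u).
have notT (u : del_vertices U) : inner u \notin T.
  apply: contraL (valP u) => uT; rewrite negbK inE; apply/orP; right.
  by apply/imsetP; exists (inner u); rewrite ?SubK.
pose h (u : del_vertices U) : del_vertices T := Sub (inner u) (notT u).
by apply: (@contains_subgraph_trans _ _ _ h) => // u w [] /val_inj.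
Qed.

Lemma psi_le (k : nat) (G : sgraph) (T : {set G}) :
  (0 < k)%N -> path_vertex_cover k T -> (psi k G <= #|T|)%N.
Proof.
move=> k_gt0 coverT; rewrite /psi.
by case: arg_minnP => [|U _]; [exact: path_vertex_coverT | apply].
Qed.

Lemma psi_attained (k : nat) (G : sgraph) :
  (0 < k)%N -> exists2 T : {set G}, path_vertex_cover k T & #|T| = psi k G.
Proof.
move=> k_gt0; rewrite /psi.
by case: arg_minnP => [|T coverT _]; [exact: path_vertex_coverT | exists T].
Qed.

Lemma psi_del_vertices (k : nat) (G : sgraph) (S : {set G}) :
  (0 < k)%N -> (psi k G <= #|S| + psi k (del_vertices S))%N.
Proof.
move=> k_gt0; have [T coverT <-] := psi_attained (del_vertices S) k_gt0.
apply: leq_trans (psi_le k_gt0 (path_vertex_coverU coverT)) _.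
by apply: leq_trans (leq_card_setU _ _) _; rewrite leq_add2l leq_imset_card.
Qed.

Lemma card_del_vertex (G : sgraph) (v : G) :
  #|G| = #|del_vertices [set v]|.+1.
Proof.
rewrite card_sig (cardD1 v) inE add1n; congr _.+1.
by apply: eq_card => u; rewrite !inE andbT.
Qed.

Theorem theorem6 (R : realType) (a b : R) (k : nat)
  (ha : 0 <= a) (hb : 0 <= b) (hb0 : b != 0) (hk : (3 <= k)%N)
  (hpsi : forall G : sgraph,
     (psi k G)%:R <= a * #|G|%:R + b * #|edges G|%:R)
  (x : nat) (hx : (0 < x)%N)
  (hxl : (1 - a - b) / b <= x%:R) (hxu : x%:R <= (2 - 2 * a) / b)
  (a' b' : R)
  (ha' : a' = a + b * x%:R - x%:R * (1 + b - a) / (x%:R + 2))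
  (hb' : b' = (2 - 2 * a - b * x%:R) / (x%:R + 2)) :
  forall G : sgraph,
    (psi k G)%:R <= a' * #|G|%:R + b' * #|edges G|%:R.
Proof.
have b_gt0 : 0 < b by rewrite lt_def hb0.
have x2_gt0 : 0 < x%:R + 2 :> R by rewrite ltr_wpDl.
have x2_neq0 : x%:R + 2 != 0 :> R by rewrite gt_eqF.
move: hxl hxu; rewrite ler_pdivrMr // ler_pdivlMr // => hxl hxu.
have b'_ge0 : 0 <= b' by rewrite hb' divr_ge0 ?(ltW x2_gt0) //; lra.
have a'b'1 : a' + b' * (x%:R + 1) = 1 by rewrite ha' hb'; field.
(* [c] is the loss of slope; the lines cross at average degree [x]. *)
pose c : R := (x%:R * b - (1 - a - b)) / (x%:R + 2).
have c_ge0 : 0 <= c by rewrite divr_ge0 ?(ltW x2_gt0) // subr_ge0.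
have a'E : a' = a + c * x%:R by rewrite ha' /c; field.
have b'E : b' = b - 2 * c by rewrite hb' /c; field.
have low_degree (G : sgraph) : (forall v : G, #|incident v| <= x)%N ->
    (psi k G)%:R <= a' * #|G|%:R + b' * #|edges G|%:R.
  move=> small; apply: le_trans (hpsi G) _; rewrite a'E b'E -subr_ge0.
  have -> : (a + c * x%:R) * #|G|%:R + (b - 2 * c) * #|edges G|%:R
      - (a * #|G|%:R + b * #|edges G|%:R)
      = c * ((x * #|G|)%:R - (2 * #|edges G|)%:R) by rewrite !natrM; ring.
  by rewrite mulr_ge0 // subr_ge0 ler_nat card_edges_le.
move=> G; have [n cardG] : exists n, #|G| = n by exists #|G|.
elim: n G cardG => [|n IHn] G cardG.
  by apply: low_degree => v; have := card_del_vertex v; rewrite cardG.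
have [/forallP|] := boolP [forall v : G, #|incident v| <= x]%N.
  exact: low_degree.
case/forallPn => v; rewrite -ltnNge => big.
have cardGv : #|del_vertices [set v]| = n.
  by apply: succn_inj; rewrite -card_del_vertex.
have := IHn _ cardGv; rewrite cardG cardGv => IHv.
have psi_v : (psi k G)%:R <= 1 + (psi k (del_vertices [set v]))%:R :> R.
  rewrite nat1r ler_nat -add1n -(cards1 v); apply: psi_del_vertices.
  exact: leq_trans hk.
have edges_v : x%:R + 1 + #|edges (del_vertices [set v])|%:R
    <= #|edges G|%:R :> R.
  rewrite natr1 -natrD ler_nat; apply: leq_trans (edges_del_vertex v).
  by rewrite leq_add2r.
have := ler_wpM2l b'_ge0 edges_v; rewrite -natr1; lra.
Qed.
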